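(* Let $\Omega$ be a finite set, let $\Delta(\Omega)$ be the closed probability simplex on $\Omega$, and let $T\Delta(\Omega)=\{(p,v) : p\in\Delta(\Omega),\ v\in T_p\Delta(\Omega)\}$ be its tangent bundle, where $T_p\Delta(\Omega)$ is the set of velocities at $p$ of $C^1$ curves in $\Delta(\Omega)$ through $p$. Then $$T\Delta(\Omega)=\Big\{(p,v) : p\in\Delta(\Omega),\ v\in\mathbb{R}^{\Omega},\ \sum_{x\in\Omega}v(x)=0,\ \operatorname{supp} v\subseteq\operatorname{supp} p\Big\}.$$
   Context: $\Omega$ is a finite set with $d$ elements and $\mathbb{R}^\Omega$ is the space of real-valued functions on $\Omega$. The (closed) probability simplex is $\Delta(\Omega)=\{p\in\mathbb{R}^\Omega : p(x)\ge 0 \text{ for all } x\in\Omega,\ \sum_{x\in\Omega}p(x)=1\}$. For $v\in\mathbb{R}^\Omega$, $\operatorname{supp} v=\{x\in\Omega : v(x)\neq 0\}$. For $p\in\Delta(\Omega)$, the tangent space at $p$ is $$T_p\Delta(\Omega)=\{v\in\mathbb{R}^\Omega : \text{there exists a } C^1 \text{ curve } \gamma\colon I\to\Delta(\Omega) \text{ with } \gamma(0)=p,\ \dot\gamma(0)=v\},$$ where $I\subseteq\mathbb{R}$ is an open interval containing $0$, $\gamma$ is $C^1$ as a map into $\mathbb{R}^\Omega$, and $\dot\gamma$ is its derivative in $t$. *)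

(* Defs.v *)
From HB Require Import structures.
From mathcomp Require Import all_boot all_order all_algebra.
From mathcomp Require Import all_classical all_reals all_analysis.

Set Implicit Arguments.
Unset Strict Implicit.
Unset Printing Implicit Defensive.

Import Order.TTheory GRing.Theory Num.Theory.
Import numFieldNormedType.Exports.

Local Open Scope classical_set_scope.
Local Open Scope ring_scope.

(* R^Omega is [{ffun Omega -> R}].  The library does not make this type a
   normed module; it gets the sup norm here, so that [derivable], [derive1] and
   [continuous] apply to curves in R^Omega.  Omega being finite, any other
   norm would give the same C^1 curves and derivatives. *)
Section FfunNorm.
Context {R : realType} {Omega : finType}.
Implicit Types u v : {ffun Omega -> R}.

Definition ffun_norm v : R := \big[Num.max/0]_(x : Omega) `|v x|.

Lemma ffun_norm_ge0 v : 0 <= ffun_norm v.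
Proof. exact: bigmax_ge_id. Qed.

Lemma ler_ffun_norm v x : `|v x| <= ffun_norm v.
Proof. exact: (le_bigmax _ (fun y => `|v y|)). Qed.

Lemma ffun_normP v (c : R) :
  0 <= c -> (forall x, `|v x| <= c) -> ffun_norm v <= c.
Proof. by move=> c0 vc; apply/bigmax_leP; split => // x _; exact: vc. Qed.

Fact ffun_normD u v : ffun_norm (u + v) <= ffun_norm u + ffun_norm v.
Proof.
apply: ffun_normP => [|x]; first by rewrite addr_ge0 ?ffun_norm_ge0.
by rewrite ffunE (le_trans (ler_normD _ _))// lerD ?ler_ffun_norm.
Qed.

Fact ffun_normZ (a : R) v : ffun_norm (a *: v) = `|a| * ffun_norm v.
Proof.
have le_scale (b : R) w : ffun_norm (b *: w) <= `|b| * ffun_norm w.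
  apply: ffun_normP => [|x]; first by rewrite mulr_ge0 ?ffun_norm_ge0.
  by rewrite ffunE normrM ler_wpM2l ?ler_ffun_norm.
apply/eqP; rewrite eq_le le_scale /=.
have [->|a0] := eqVneq a 0; first by rewrite normr0 mul0r ffun_norm_ge0.
rewrite mulrC -ler_pdivlMr ?normr_gt0// mulrC -normfV.
by rewrite -{1}[v](scalerK a0) le_scale.
Qed.

Fact ffun_norm0_eq0 v : ffun_norm v = 0 -> v = 0.
Proof.
move=> v0; apply/ffunP => x; rewrite ffunE; apply/eqP.
by rewrite -normr_le0 -v0 ler_ffun_norm.
Qed.

End FfunNorm.

HB.instance Definition _ (R : realType) (Omega : finType) :=
  @Lmodule_isNormed.Build R {ffun Omega -> R} (@ffun_norm R Omega)
    ffun_normD ffun_normZ ffun_norm0_eq0.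

Section Simplex.
Context (R : realType) (Omega : finType).
Implicit Types p v : {ffun Omega -> R}.

Definition simplex : set {ffun Omega -> R} :=
  [set p | (forall x, 0 <= p x) /\ \sum_x p x = 1].

(* A curve I -> Delta(Omega) is a total function of which only the values on
   the open interval I matter. *)
Definition C1_curve_in_simplex (I : set R) (gamma : R -> {ffun Omega -> R}) :=
  [/\ forall t, I t -> simplex (gamma t),
      forall t, I t -> derivable gamma t 1
    & {within I, continuous (derive1 gamma)}].

Definition tangent_space p : set {ffun Omega -> R} :=
  [set v | exists (I : set R) (gamma : R -> {ffun Omega -> R}),
    [/\ open I, is_interval I & I 0] /\
    [/\ C1_curve_in_simplex I gamma, gamma 0 = p & derive1 gamma 0 = v]].

Definition tangent_bundle : set ({ffun Omega -> R} * {ffun Omega -> R}) :=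
  [set pv | simplex pv.1 /\ tangent_space pv.1 pv.2].

End Simplex.

Arguments simplex R Omega : clear implicits.
Arguments tangent_bundle R Omega : clear implicits.

(* Main.v *)
(* A coordinate of a curve in the simplex is minimal at any time when it vanishes,
   so its derivative is zero there, and the coordinate sum is constant; conversely,
   if [supp v] is contained in [supp p], then the line [p + t v] stays in the
   simplex for small [t]. *)

Require Import Defs.
From mathcomp Require Import all_boot all_order all_algebra.
From mathcomp Require Import all_classical all_reals all_analysis.
Import Order.TTheory GRing.Theory Num.Theory.
Import numFieldNormedType.Exports.
Local Open Scope classical_set_scope.
Local Open Scope ring_scope.

Section Derivatives.
Context {R : realType} {V : normedModType R}.

(** Linearity turns [L v - L w] into [L (v - w)], which the bound controls. *)
Lemma scalar_bounded_continuous (L : V -> R) (C : R) :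
  scalar L -> (forall v, `|L v| <= C * `|v|) -> continuous L.
Proof.
move=> linL LC v; apply/cvgrPdist_lt => e e0.
(* [C] has no assumed sign; this larger constant is positive, so [e] can be divided by it. *)
have C0 : 0 < `|C| + 1 by rewrite ltr_wpDl.
have LB u w : L u - L w = L (u - w).
  by rewrite addrC -mulN1r -linL scaleN1r addrC.
near=> w; rewrite LB (le_lt_trans (LC _))//.
rewrite (@le_lt_trans _ _ ((`|C| + 1) * `|v - w|))//.
  by rewrite ler_wpM2r// (le_trans (ler_norm C))// lerDl.
rewrite mulrC -ltr_pdivlMr//.
by near: w; apply: cvgr_dist_lt => //; exact: divr_gt0.
Unshelve. all: by end_near. Qed.

(** The difference quotient of [L \o gamma] is [L] of that of [gamma], and continuity of [L] passes
    to the limit. *)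
Lemma is_derive_scalar_comp (L : V -> R) (gamma : R -> V) (t : R) :
  scalar L -> continuous L -> derivable gamma t 1 ->
  is_derive t (1 : R) (fun s => L (gamma s)) (L ('D_1 gamma t)).
Proof.
move=> linL cL dgamma.
have cvg_L : h^-1 *: (L (gamma (h *: 1 + t)) - L (gamma t)) @[h --> 0^'] -->
    L ('D_1 gamma t).
  have -> : (fun h : R => h^-1 *: (L (gamma (h *: 1 + t)) - L (gamma t))) =
      L \o (fun h : R => h^-1 *: (gamma (h *: 1 + t) - gamma t)).
    apply/funext => h /=; have L0 : L 0 = 0.
      by have := linL 1 0 0; rewrite scale1r mul1r addr0 => /eqP;
        rewrite -subr_eq subrr => /eqP.
    rewrite -[h^-1 *: (gamma _ - _)]addr0 linL L0 addr0; congr (_ * _).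
    by rewrite addrC -mulN1r -linL scaleN1r addrC.
  apply: (cvg_comp _ L); last exact: cL.
  exact: dgamma.
apply: DeriveDef; first by apply/cvg_ex; eexists; exact: cvg_L.
exact: (cvg_lim _ cvg_L).
Qed.

(** Fermat's rule: a ball around [c] inside [I] is an open interval, to which [derive1_at_min]
    applies. *)
Lemma is_derive_min_eq0 (I : set R) (f : R -> R) (c df : R) :
  open I -> I c -> (forall t, I t -> derivable f t 1) ->
  is_derive c (1 : R) f df -> (forall t, I t -> f c <= f t) -> df = 0.
Proof.
move=> oI Ic dI dc minc.
have /nbhs_ballP[e /= e0 eI] : nbhs c I by exact: open_nbhs_nbhs.
have sub t : t \in `](c - e), (c + e)[ -> I t.
  by move=> tI; apply: eI; rewrite ball_itv.
have c_in : c \in `](c - e), (c + e)[.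
  by rewrite in_itv /= ltrBlDr ltrDl e0.
have lt_ends : c - e <= c + e.
  by move: c_in; rewrite in_itv => /andP[ac cb]; exact: ltW (lt_trans ac cb).
have := @derive1_at_min R f _ _ c lt_ends (fun t tI => dI t (sub t tI)) c_in
  (fun t tI => minc t (sub t tI)).
by move=> [_ d0]; case: dc => [_ <-].
Qed.

Lemma is_derive_line (p v : V) (t : R) :
  is_derive t (1 : R) (fun s : R => p + s *: v) v.
Proof.
have cvg_line : h^-1 *: ((p + (h *: 1 + t) *: v) - (p + t *: v))
    @[h --> (0 : R)^'] --> v.
  apply: cvg_near_cst; near=> h.
  rewrite opprD addrACA subrr add0r -scalerBl addrK scalerA mulrA mulVf.
    by rewrite mul1r scale1r.
  by near: h; exact: nbhs_dnbhs_neq.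
apply: DeriveDef; first by apply/cvg_ex; eexists; exact: cvg_line.
exact: (cvg_lim _ cvg_line).
Unshelve. all: by end_near. Qed.

End Derivatives.

Section Coordinates.
Context {R : realType} {Omega : finType}.
Implicit Types (p v : {ffun Omega -> R}) (x : Omega).

Lemma scalar_ffun_eval x : scalar (fun v : {ffun Omega -> R} => v x).
Proof. by move=> a u v; rewrite !ffunE. Qed.

Lemma scalar_ffun_sum : scalar (fun v : {ffun Omega -> R} => \sum_x v x).
Proof.
move=> a u v; rewrite mulr_sumr -big_split /=.
by apply: eq_bigr => x _; rewrite !ffunE.
Qed.

Lemma continuous_ffun_eval x : continuous (fun v : {ffun Omega -> R} => v x).
Proof.
apply: (@scalar_bounded_continuous _ _ _ 1 (scalar_ffun_eval x)) => v.
by rewrite mul1r; exact: ler_ffun_norm.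
Qed.

Lemma continuous_ffun_sum : continuous (fun v : {ffun Omega -> R} => \sum_x v x).
Proof.
(* Each of the [#|Omega|] terms is at most the sup norm. *)
apply: (@scalar_bounded_continuous _ _ _ #|Omega|%:R scalar_ffun_sum) => v.
rewrite (le_trans (ler_norm_sum _ _ _))// mulr_natl -sumr_const.
by apply: ler_sum => x _; exact: ler_ffun_norm.
Qed.

(** Where [p x = 0], the support condition gives [v x = 0] and the coordinate stays zero; where
    [p x > 0], continuity keeps it positive near [t = 0]. *)
Lemma near_simplex_line p v :
  simplex R Omega p -> \sum_x v x = 0 -> {subset support v <= support p} ->
  \forall t \near (0 : R), simplex R Omega (p + t *: v).
Proof.
move=> [p0 p1] v0 vp.
have : \forall t \near (0 : R), forall x, 0 <= p x + t * v x.
  (* Finiteness of [Omega] yields one neighbourhood valid for all coordinates. *)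
  apply: (@filter_forall R Omega (fun x t => 0 <= p x + t * v x) (nbhs (0 : R)) _).
  move=> x.
  have [px0|px0] := eqVneq (p x) 0.
    have -> : v x = 0.
      by apply: contra_eq px0; exact: vp.
    by apply: nearW => t; rewrite mulr0 addr0.
  have : p x + t * v x @[t --> (0 : R)] --> p x + 0 * v x.
    by apply: cvgD; [exact: cvg_cst|apply: cvgMl; exact: cvg_id].
  rewrite mul0r addr0 => /cvgr_gt /(_ 0).
  rewrite lt_neqAle eq_sym px0 p0 => /(_ isT); apply: filterS => t.
  exact: ltW.
apply: filterS => t pos; split => [x|]; first by rewrite !ffunE.
under eq_bigr => x _ do rewrite !ffunE.
by rewrite big_split /= -mulr_sumr v0 mulr0 addr0.
Qed.

End Coordinates.

Theorem theorem2p1 (R : realType) (Omega : finType) :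
  tangent_bundle R Omega =
  [set pv : {ffun Omega -> R} * {ffun Omega -> R} |
    [/\ simplex R Omega pv.1, \sum_x pv.2 x = 0 &
        {subset support pv.2 <= support pv.1}]].
Proof.
apply/seteqP; split => [[p v]|[p v]] /=.
  case=> _ [I [gamma [[oI _ I0]]]] /= [[inS dI _] <- <-].
  (* A single minimum argument serves both conditions, with [L] the coordinate sum or an
     evaluation. *)
  have d0 (L : {ffun Omega -> R} -> R) : scalar L -> continuous L ->
      (forall t, I t -> L (gamma 0) <= L (gamma t)) -> L (derive1 gamma 0) = 0.
    move=> linL cL minL; rewrite derive1E.
    have dL t (It : I t) := is_derive_scalar_comp L gamma t linL cL (dI t It).
    by apply: (is_derive_min_eq0 _ _ _ _ oI I0 _ (dL 0 I0) minL) => t /dL[].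
  split => /=; first exact: inS.
    (* The sum is constantly 1 on [I], so time 0 is trivially a minimum. *)
    apply: (d0 _ scalar_ffun_sum continuous_ffun_sum) => t It.
    by rewrite (inS t It).2 (inS 0 I0).2.
  move=> x; rewrite !inE; apply: contra_neq => g0.
  apply: (d0 _ (scalar_ffun_eval x) (continuous_ffun_eval x)) => t It.
  by rewrite g0; exact: (inS t It).1.
case=> simplex_p v0 vp; split => //.
have /nbhs_ballP[e /= e0 eS] := near_simplex_line p v simplex_p v0 vp.
have dline : derive1 (fun s : R => p + s *: v) = cst v.
  by apply/funext => t; rewrite derive1E; case: (is_derive_line p v t).
(* On this ball the line stays in the simplex; its derivative is constant, hence continuous. *)
exists (ball (0 : R) e), (fun s => p + s *: v); split.
  split; [exact: ball_open| |exact: ballxx].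
  rewrite ball_itv; exact: interval_is_interval.
split; last by rewrite dline.
  split => [t /eS//|t _|]; first by case: (is_derive_line p v t).
  by rewrite dline; exact: cst_continuous.
by rewrite scale0r addr0.
Qed.
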